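(* Let $\alpha\in(1/2,1)$ and let $f$ satisfy: $f:\mathbb{R}\to\mathbb{R}$ is continuous, $f\ge 0$ on $\mathbb{R}$, $\operatorname{supp} f=[\theta,1]$ for some $\theta\in(0,1)$, and $f'(1)<0$. Let $(\phi_0,c_0)$ be the unique solution of $$(-\partial_{xx})^\alpha\phi_0+c_0\,\phi_0'=f(\phi_0)\ \text{ on }\mathbb{R},\qquad \lim_{x\to-\infty}\phi_0=0,\quad \lim_{x\to+\infty}\phi_0=1,\quad \phi_0(0)=\theta.$$ Then there exist constants $m,M>0$ such that $$\phi_0(x)\le \frac{M}{|x|^{2\alpha-1}}\quad\text{and}\quad \phi_0'(x)\ge\frac{m}{|x|^{2\alpha}}\qquad\text{for all }x\le -1.$$
   Context: The fractional Laplacian is $(-\partial_{xx})^\alpha u(x)=c_\alpha\,\mathrm{PV}\!\int_{\mathbb{R}}\frac{u(x)-u(z)}{|x-z|^{1+2\alpha}}\,dz$, with $c_\alpha>0$ the standard normalizing constant (Fourier symbol $|\xi|^{2\alpha}$). Existence and uniqueness of $(\phi_0,c_0)$ (with $c_0>0$ and $\phi_0$ increasing) is known under these hypotheses. *)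

(* Defs.v *)
From Stdlib Require Import Reals Lra.
Open Scope R_scope.

Definition Rint_on (g : R -> R) (a b v : R) : Prop :=
  exists pr : Riemann_integrable g a b, RiemannInt pr = v.

Definition improper_int_0_inf (g : R -> R) (l : R) : Prop :=
  forall eps, 0 < eps -> exists d K, 0 < d /\ 0 < K /\
    forall e Rr, 0 < e < d -> K < Rr ->
      exists v, Rint_on g e Rr v /\ Rabs (v - l) < eps.

(* Standard normalizing constant of the fractional Laplacian (Fourier symbol
   |xi|^(2 alpha)):  c_alpha = ( int_R (1 - cos z) / |z|^(1+2 alpha) dz )^(-1).
   The integrand is even, so the integral over R is twice that over (0,oo). *)
Definition is_c_alpha (alpha c : R) : Prop :=
  exists l, improper_int_0_inf
              (fun z => (1 - cos z) / Rpower z (1 + 2 * alpha)) l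
         /\ c = / (2 * l).

Definition frac_lap (alpha c : R) (u : R -> R) (x v : R) : Prop :=
  let g := fun z => (u x - u z) / Rpower (Rabs (x - z)) (1 + 2 * alpha) in
  forall eps, 0 < eps -> exists d K, 0 < d /\ 0 < K /\
    forall e Rr, 0 < e < d -> K < Rr ->
      exists v1 v2, Rint_on g (x - Rr) (x - e) v1 /\
                    Rint_on g (x + e) (x + Rr) v2 /\
                    Rabs (c * (v1 + v2) - v) < eps.

Definition support_is (f : R -> R) (a b : R) : Prop :=
  forall x, (a <= x <= b) <->
    (forall eps, 0 < eps -> exists y, Rabs (y - x) < eps /\ f y <> 0).

Definition left_deriv (f : R -> R) (x l : R) : Prop :=
  forall eps, 0 < eps -> exists d, 0 < d /\
    forall h, - d < h < 0 -> Rabs ((f (x + h) - f x) / h - l) < eps.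

Definition lim_minus_infty (u : R -> R) (l : R) : Prop :=
  forall eps, 0 < eps -> exists A, forall x, x < A -> Rabs (u x - l) < eps.

Definition lim_plus_infty (u : R -> R) (l : R) : Prop :=
  forall eps, 0 < eps -> exists A, forall x, A < x -> Rabs (u x - l) < eps.

(* Main.v *)
Require Import Defs.
From Stdlib Require Import Reals Lra.
From Coquelicot Require Import Coquelicot.
Open Scope R_scope.

(** On [x < 0] the reaction term vanishes, so [c0 phi' = - (-d_xx)^alpha phi] there, and both
    bounds follow from comparison with explicit barriers. A front that is merely differentiable
    can be tested pointwise: where [phi] minus a barrier attains its extremum, the slopes agree
    and the fractional Laplacians are ordered.
    Upper bound: [min 1 (M |x|^(1 - 2 alpha))] is a supersolution for large [M], because the
    transport term [c0 M (2 alpha - 1) |x|^(-2 alpha)] dominates the mass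
    [O(|x|^(-2 alpha))] that jumps in from the right.
    Lower bound: the difference quotients [(phi (x + h) - phi x) / h] solve the same linear
    equation and carry a mass bounded below near the origin, which contributes a forcing of
    order [|x|^(-1 - 2 alpha)]; this lifts them above a small multiple of a barrier of order
    [|x|^(-2 alpha)], uniformly in [h], and [h] tends to [0]. *)

(** * Integration of real powers *)

Lemma continuous_mult_Rpower (g : R -> R) (k z : R) :
  0 < z -> continuous g z -> continuous (fun r => g r * Rpower r k) z.
Proof.
  intros Hz Hg.
  apply (continuous_mult g (fun r => Rpower r k)); [exact Hg|].
  apply (ex_derive_continuous (fun r => Rpower r k)).
  exists (k * Rpower z (k - 1)).
  apply is_derive_Reals, derivable_pt_lim_power, Hz.
Qed.

Lemma ex_RInt_mult_Rpower (g : R -> R) (k a b : R) :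
  0 < a <= b -> (forall x, continuous g x) ->
  ex_RInt (fun r => g r * Rpower r k) a b.
Proof.
  intros Hab Hg.
  apply (@ex_RInt_continuous R_CompleteNormedModule).
  intros z Hz. rewrite Rmin_left in Hz by lra.
  apply continuous_mult_Rpower; [lra|apply Hg].
Qed.

Lemma RInt_Rpower (k a b : R) :
  0 < a <= b -> k <> 0 ->
  RInt (fun r => Rpower r (k - 1)) a b = (Rpower b k - Rpower a k) / k.
Proof.
  intros Hab Hk.
  apply is_RInt_unique.
  replace ((Rpower b k - Rpower a k) / k)
    with (minus (Rpower b k / k) (Rpower a k / k))
    by (unfold minus, plus, opp; simpl; field; exact Hk).
  apply (is_RInt_derive (fun r => Rpower r k / k) (fun r => Rpower r (k - 1))).
  - intros x Hx. rewrite Rmin_left in Hx by lra.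
    apply is_derive_ext with (fun r => / k * Rpower r k).
    { intros t. unfold Rdiv. apply Rmult_comm. }
    replace (Rpower x (k - 1)) with (/ k * (k * Rpower x (k - 1))) by (field; exact Hk).
    apply is_derive_scal, is_derive_Reals, derivable_pt_lim_power. lra.
  - intros x Hx. rewrite Rmin_left in Hx by lra.
    apply continuous_ext with (fun r => 1 * Rpower r (k - 1)).
    { intros t. apply Rmult_1_l. }
    apply continuous_mult_Rpower; [lra|apply continuous_const].
Qed.

(** * The fractional Laplacian in second-difference form *)

Definition second_diff_kernel (a : R) (u : R -> R) (x r : R) : R :=
  (2 * u x - u (x + r) - u (x - r)) * Rpower r (- (1 + 2 * a)).

(** Folding the two half-lines by z = x + r and z = x - r turns the principal value into one
    integral over r > 0, in which linear terms at [x] cancel pointwise. [RInt] is total; the later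
    lemmas supply integrability through the continuity of [u]. *)
Definition sym_frac_lap (a c : R) (u : R -> R) (x v : R) : Prop :=
  forall eps, 0 < eps -> exists d K, 0 < d /\ 0 < K /\
    forall e Rr, 0 < e < d -> K < Rr ->
      Rabs (c * RInt (second_diff_kernel a u x) e Rr - v) < eps.

Lemma continuous_second_diff (u : R -> R) (x r : R) :
  (forall y, continuous u y) ->
  continuous (fun r => 2 * u x - u (x + r) - u (x - r)) r.
Proof.
  intros Hu.
  apply (continuous_minus (fun r => 2 * u x - u (x + r)) (fun r => u (x - r))).
  - apply (continuous_minus (fun _ => 2 * u x) (fun r => u (x + r))).
    + apply continuous_const.
    + apply (continuous_comp (fun r => x + r) u); [|apply Hu].
      apply (continuous_plus (fun _ => x) (fun r => r));
        [apply continuous_const|apply continuous_id].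
  - apply (continuous_comp (fun r => x - r) u); [|apply Hu].
    apply (continuous_minus (fun _ => x) (fun r => r));
      [apply continuous_const|apply continuous_id].
Qed.

Lemma ex_RInt_second_diff_kernel (a : R) (u : R -> R) (x e b : R) :
  0 < e <= b -> (forall y, continuous u y) ->
  ex_RInt (second_diff_kernel a u x) e b.
Proof.
  intros He Hu. apply (ex_RInt_mult_Rpower (fun r => 2 * u x - u (x + r) - u (x - r))).
  - exact He.
  - intros r. now apply continuous_second_diff.
Qed.

Lemma frac_lap_sym (a c : R) (u : R -> R) (x v : R) :
  frac_lap a c u x v -> sym_frac_lap a c u x v.
Proof.
  intros H eps Heps.
  destruct (H eps Heps) as (d & K & Hd & HK & HH).
  (* Including [d] in the threshold forces e < Rr, so the folded interval is correctly oriented. *)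
  exists d, (Rmax K d). split; [exact Hd|]. split.
  { apply Rlt_le_trans with K; [exact HK|apply Rmax_l]. }
  intros e Rr He HR.
  assert (HKR : K < Rr) by (apply Rle_lt_trans with (2 := HR), Rmax_l).
  assert (HdR : d < Rr) by (apply Rle_lt_trans with (2 := HR), Rmax_r).
  destruct (HH e Rr He HKR) as (v1 & v2 & [p1 <-] & [p2 <-] & Hv).
  rewrite <- !RInt_Reals in Hv.
  apply ex_RInt_Reals_1 in p1. apply ex_RInt_Reals_1 in p2.
  set (g := fun z => (u x - u z) / Rpower (Rabs (x - z)) (1 + 2 * a)) in *.
  replace (RInt (second_diff_kernel a u x) e Rr)
    with (RInt g (x - Rr) (x - e) + RInt g (x + e) (x + Rr)); [exact Hv|].
  assert (E1 : ex_RInt g (-1 * Rr + x) (-1 * e + x)).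
  { replace (-1 * Rr + x) with (x - Rr) by ring.
    replace (-1 * e + x) with (x - e) by ring. exact p1. }
  assert (E2 : ex_RInt g (1 * e + x) (1 * Rr + x)).
  { replace (1 * e + x) with (x + e) by ring.
    replace (1 * Rr + x) with (x + Rr) by ring. exact p2. }
  replace (x - Rr) with (-1 * Rr + x) by ring.
  replace (x - e) with (-1 * e + x) by ring.
  replace (x + e) with (1 * e + x) by ring.
  replace (x + Rr) with (1 * Rr + x) by ring.
  assert (X1 := ex_RInt_comp_lin (V := R_NormedModule) g (-1) x Rr e E1).
  assert (X2 := ex_RInt_comp_lin (V := R_NormedModule) g 1 x e Rr E2).
  apply ex_RInt_swap in X1.
  (* The reflection reverses the left half-line: its Jacobian -1 and the swap of endpoints
     cancel. *)
  transitivity (RInt (fun y => - (-1 * g (-1 * y + x)) + 1 * g (1 * y + x)) e Rr).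
  { symmetry. etransitivity.
    - apply (RInt_plus (V := R_CompleteNormedModule) (fun y => - (-1 * g (-1 * y + x)))).
      + now apply (ex_RInt_opp (V := R_NormedModule) (fun y => -1 * g (-1 * y + x))).
      + exact X2.
    - apply (f_equal2 Rplus).
      + etransitivity; [now apply (RInt_opp (V := R_CompleteNormedModule)
                                    (fun y => -1 * g (-1 * y + x)))|].
        etransitivity; [now apply (opp_RInt_swap (V := R_CompleteNormedModule))|].
        now apply (RInt_comp_lin (V := R_CompleteNormedModule) g).
      + now apply (RInt_comp_lin (V := R_CompleteNormedModule) g). }
  apply RInt_ext. intros r. rewrite Rmin_left, Rmax_right by lra. intros Hr.
  unfold g, second_diff_kernel.
  replace (x - (-1 * r + x)) with r by ring.
  replace (x - (1 * r + x)) with (- r) by ring.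
  rewrite Rabs_Ropp, Rabs_pos_eq by lra.
  rewrite Rpower_Ropp.
  replace (-1 * r + x) with (x - r) by ring.
  replace (1 * r + x) with (x + r) by ring.
  match goal with |- ?l = ?r => change (@eq R l r) end.
  unfold Rdiv. ring.
Qed.

(** Linearity and translation invariance of the operator. The quotient carries a minus sign because
    the touching test treats contact from above, while the lower bound needs contact from below. *)
Lemma sym_frac_lap_neg_diff_quot (a c h : R) (u : R -> R) (x v w : R) :
  (forall y, continuous u y) ->
  sym_frac_lap a c u x v -> sym_frac_lap a c u (x + h) w -> 0 < h ->
  sym_frac_lap a c (fun y => (u y - u (y + h)) / h) x ((v - w) / h).
Proof.
  intros Hu Hv Hw Hh eps Heps.
  (* Two errors are added and then divided by [h]. *)
  assert (Heh : 0 < eps * h / 2) by (apply Rmult_lt_0_compat; [now apply Rmult_lt_0_compat|lra]).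
  destruct (Hv _ Heh) as (d1 & K1 & Hd1 & HK1 & H1).
  destruct (Hw _ Heh) as (d2 & K2 & Hd2 & HK2 & H2).
  set (d := Rmin d1 d2).
  assert (D1 := Rmin_l d1 d2). assert (D2 := Rmin_r d1 d2). fold d in D1, D2.
  assert (Hd : 0 < d) by now apply Rmin_glb_lt.
  assert (M1 := Rmax_l K1 K2). assert (M2 := Rmax_r K1 K2).
  exists d, (Rmax K1 K2 + d).
  split; [exact Hd|]. split; [lra|].
  intros e Rr He HR.
  specialize (H1 e Rr ltac:(lra) ltac:(lra)).
  specialize (H2 e Rr ltac:(lra) ltac:(lra)).
  assert (E1 := ex_RInt_second_diff_kernel a u x e Rr ltac:(lra) Hu).
  assert (E2 := ex_RInt_second_diff_kernel a u (x + h) e Rr ltac:(lra) Hu).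
  replace (RInt (second_diff_kernel a (fun y => (u y - u (y + h)) / h) x) e Rr)
    with (/ h * (RInt (second_diff_kernel a u x) e Rr
                 - RInt (second_diff_kernel a u (x + h)) e Rr)).
  2: { etransitivity; [apply (f_equal (Rmult (/ h))); symmetry;
         apply (RInt_minus _ _ _ _ E1 E2)|].
    etransitivity; [symmetry; apply (RInt_scal (V := R_CompleteNormedModule));
         now apply (@ex_RInt_minus R_NormedModule)|].
    apply RInt_ext. intros r _.
    unfold second_diff_kernel, minus, plus, opp, scal; simpl. unfold mult; simpl.
    replace (x + r + h) with (x + h + r) by ring.
    replace (x - r + h) with (x + h - r) by ring.
    match goal with |- ?l = ?r => change (@eq R l r) end.
    unfold Rdiv. ring. }
  set (I1 := RInt (second_diff_kernel a u x) e Rr) in *.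
  set (I2 := RInt (second_diff_kernel a u (x + h)) e Rr) in *.
  replace (c * (/ h * (I1 - I2)) - (v - w) / h)
    with (((c * I1 - v) - (c * I2 - w)) / h) by (field; lra).
  unfold Rdiv. rewrite Rabs_mult, (Rabs_pos_eq (/ h)) by (left; now apply Rinv_0_lt_compat).
  apply Rmult_lt_reg_r with h; [exact Hh|].
  rewrite Rmult_assoc, Rinv_l, Rmult_1_r by lra.
  apply Rabs_def2 in H1. apply Rabs_def2 in H2.
  apply Rabs_def1; lra.
Qed.

(** * Testing the equation at a touching point *)

(** [u] minus the paraboloid has an interior maximum at [x], so its derivative vanishes there. *)
Lemma touching_slope (u : R -> R) (x l b D rho : R) :
  0 < rho -> derivable_pt_lim u x l ->
  (forall z, Rabs (z - x) <= rho -> u z - u x <= b * (z - x) + D * (z - x) ^ 2) ->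
  l = b.
Proof.
  intros Hrho Hl Ht.
  set (k := fun z => u z - (b * (z - x) + D * (z - x) ^ 2)).
  assert (Hk : derivable_pt_lim k x (l - b)).
  { apply is_derive_Reals.
    apply (is_derive_minus u (fun z => b * (z - x) + D * (z - x) ^ 2) x l b).
    - now apply is_derive_Reals.
    - auto_derive; [exact I|ring]. }
  assert (Hm := deriv_maximum k (x - rho) (x + rho) x (exist _ (l - b) Hk)
                  ltac:(lra) ltac:(lra)).
  enough (l - b = 0) by lra.
  apply Hm. intros z Hz1 Hz2.
  assert (Ha : Rabs (z - x) <= rho) by (apply Rabs_le; lra).
  specialize (Ht z Ha). unfold k.
  replace (x - x) with 0 by ring. lra.
Qed.

(* [g] is the gain over the trivial bound [K] on the window [s, t] of jump lengths;
   the linear term of the paraboloid cancels by symmetry. *)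
Lemma touching_frac_lap (a c : R) (u g : R -> R) (x v b D rho K s t G : R) :
  1 / 2 < a < 1 -> 0 < c -> 0 < rho <= s -> s <= t -> 0 <= D -> 0 <= K ->
  (forall y, continuous u y) ->
  sym_frac_lap a c u x v ->
  (forall z, Rabs (z - x) <= rho -> u z - u x <= b * (z - x) + D * (z - x) ^ 2) ->
  (forall r, rho <= r -> u (x + r) + u (x - r) - 2 * u x <= K) ->
  (forall y, continuous g y) -> (forall r, s <= r <= t -> 0 <= g r) ->
  (forall r, s <= r <= t -> u (x + r) + u (x - r) - 2 * u x <= K - g r) ->
  G <= RInt g s t ->
  - v <= c * (2 * D * Rpower rho (2 - 2 * a) / (2 - 2 * a)
              + K * Rpower rho (- (2 * a)) / (2 * a)
              - G * Rpower t (- (1 + 2 * a))).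
Proof.
  intros Ha Hc Hrs Hst HD HK Hu Hlap Hnear Hfar Hg Hg0 Hwin HG.
  apply le_epsilon. intros eps Heps.
  destruct (Hlap eps Heps) as (d & T0 & Hd & HT0 & Hlim).
  set (e := Rmin d rho / 2).
  assert (He : 0 < e /\ e < d /\ e < rho).
  { unfold e. assert (H1 := Rmin_l d rho). assert (H2 := Rmin_r d rho).
    assert (0 < Rmin d rho) by (apply Rmin_glb_lt; lra). lra. }
  set (T := T0 + t).
  specialize (Hlim e T ltac:(lra) ltac:(unfold T; lra)).
  assert (HtT : t < T) by (unfold T; lra).
  set (k := second_diff_kernel a u x) in *.
  assert (Ek : forall p q, 0 < p <= q -> ex_RInt k p q)
    by (intros; now apply ex_RInt_second_diff_kernel).
  assert (Ep : forall C w p q, 0 < p <= q -> ex_RInt (fun r => C * Rpower r w) p q).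
  { intros C w p q Hpq. apply (ex_RInt_mult_Rpower (fun _ => C)); [exact Hpq|].
    intros; apply continuous_const. }
  assert (Ip : forall C w p q, 0 < p <= q -> w <> 0 ->
     RInt (fun r => C * Rpower r (w - 1)) p q = C * ((Rpower q w - Rpower p w) / w)).
  { intros C w p q Hpq Hw. rewrite <- RInt_Rpower by assumption.
    apply (RInt_scal (V := R_CompleteNormedModule) (fun r => Rpower r (w - 1))).
    apply ex_RInt_ext with (fun r => 1 * Rpower r (w - 1)).
    - intros; apply Rmult_1_l.
    - now apply Ep. }
  assert (Pos : forall y w, 0 < Rpower y w) by (intros; apply exp_pos).
  (* Near [x] the second difference of [u] is at most 2 D r^2, and r^(1 - 2 a) is integrable at 0;
     the endpoint term at [e] has a favourable sign and is dropped. *)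
  assert (N1 : - (2 * D) * Rpower rho (2 - 2 * a) / (2 - 2 * a) <= RInt k e rho).
  { apply Rle_trans with (RInt (fun r => - (2 * D) * Rpower r (2 - 2 * a - 1)) e rho).
    - rewrite Ip by lra. unfold Rdiv. rewrite !Rmult_assoc.
      apply Rmult_le_compat_neg_l; [lra|].
      apply Rmult_le_compat_r; [left; apply Rinv_0_lt_compat; lra|].
      assert (H := Pos e (2 - 2 * a)). lra.
    - apply RInt_le; [lra|apply Ep; lra|apply Ek; lra|].
      intros r Hr. unfold k, second_diff_kernel.
      replace (2 - 2 * a - 1) with (2 + - (1 + 2 * a)) by ring.
      rewrite Rpower_plus, <- Rmult_assoc.
      apply Rmult_le_compat_r; [left; apply Pos|].
      replace 2 with (INR 2) at 2 by (simpl; ring). rewrite Rpower_pow by lra.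
      assert (A1 := Hnear (x + r) ltac:(apply Rabs_le; lra)).
      assert (A2 := Hnear (x - r) ltac:(apply Rabs_le; lra)).
      nra. }
  (* Beyond [rho] only the bound [K] enters; the endpoint terms telescope over consecutive
     intervals. *)
  assert (F : forall p q, rho <= p <= q ->
    - K * ((Rpower q (- (2 * a)) - Rpower p (- (2 * a))) / (- (2 * a))) <= RInt k p q).
  { intros p q Hpq.
    rewrite <- Ip by lra.
    apply RInt_le; [lra|apply Ep; lra|apply Ek; lra|].
    intros r Hr. unfold k, second_diff_kernel.
    replace (- (2 * a) - 1) with (- (1 + 2 * a)) by ring.
    apply Rmult_le_compat_r; [left; apply Pos|].
    specialize (Hfar r ltac:(lra)). lra. }
  assert (N2 := F rho s ltac:(lra)).
  assert (N4 := F t T ltac:(lra)).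
  assert (N3 : - K * ((Rpower t (- (2 * a)) - Rpower s (- (2 * a))) / (- (2 * a)))
               + Rpower t (- (1 + 2 * a)) * RInt g s t <= RInt k s t).
  { assert (Eg : ex_RInt g s t)
      by (apply (@ex_RInt_continuous R_CompleteNormedModule); intros; apply Hg).
    rewrite <- Ip by lra.
    apply Rle_trans with (RInt (fun r => - K * Rpower r (- (2 * a) - 1)
                                  + Rpower t (- (1 + 2 * a)) * g r) s t).
    - apply Req_le. symmetry.
      etransitivity; [apply (RInt_plus (V := R_CompleteNormedModule)
         (fun r => - K * Rpower r (- (2 * a) - 1)) (fun r => Rpower t (- (1 + 2 * a)) * g r))|].
      + apply Ep; lra.
      + now apply (ex_RInt_scal (V := R_NormedModule) g).
      + apply (f_equal (Rplus _)). now apply (RInt_scal (V := R_CompleteNormedModule) g).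
    - apply RInt_le; [lra| |apply Ek; lra|].
      + apply (ex_RInt_plus (V := R_NormedModule)
           (fun r => - K * Rpower r (- (2 * a) - 1)) (fun r => Rpower t (- (1 + 2 * a)) * g r)).
        * apply Ep; lra.
        * now apply (ex_RInt_scal (V := R_NormedModule) g).
      + intros r Hr. unfold k, second_diff_kernel.
        replace (- (2 * a) - 1) with (- (1 + 2 * a)) by ring.
        (* The kernel decreases, so on the window it is at least its value at [t]. *)
        assert (Hm : Rpower t (- (1 + 2 * a)) <= Rpower r (- (1 + 2 * a))).
        { rewrite !Rpower_Ropp. apply Rinv_le_contravar; [apply Pos|].
          apply Rle_Rpower_l; lra. }
        specialize (Hwin r ltac:(lra)). specialize (Hg0 r ltac:(lra)).
        assert (Hp := Pos r (- (1 + 2 * a))).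
        assert (Rpower t (- (1 + 2 * a)) * g r <= Rpower r (- (1 + 2 * a)) * g r)
          by now apply Rmult_le_compat_r.
        assert (0 <= (K - g r - (u (x + r) + u (x - r) - 2 * u x)) * Rpower r (- (1 + 2 * a)))
          by (apply Rmult_le_pos; lra).
        lra. }
  assert (Spl : RInt k e T = RInt k e rho + RInt k rho s + RInt k s t + RInt k t T).
  { rewrite (Rplus_assoc (RInt k e rho)).
    assert (C1 := RInt_Chasles (V := R_CompleteNormedModule) k e rho s
      (Ek e rho ltac:(lra)) (Ek rho s ltac:(lra))).
    assert (C2 := RInt_Chasles (V := R_CompleteNormedModule) k e s t
      (Ek e s ltac:(lra)) (Ek s t ltac:(lra))).
    assert (C3 := RInt_Chasles (V := R_CompleteNormedModule) k e t T
      (Ek e t ltac:(lra)) (Ek t T ltac:(lra))).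
    unfold plus in *; simpl in *. lra. }
  assert (HGt : G * Rpower t (- (1 + 2 * a)) <= Rpower t (- (1 + 2 * a)) * RInt g s t).
  { rewrite Rmult_comm. apply Rmult_le_compat_l; [left; apply Pos|exact HG]. }
  assert (HT : 0 <= K * (Rpower T (- (2 * a)) / (2 * a))).
  { apply Rmult_le_pos; [exact HK|]. left. apply Rdiv_lt_0_compat; [apply Pos|lra]. }
  assert (Tot : - (2 * D * Rpower rho (2 - 2 * a) / (2 - 2 * a)
              + K * Rpower rho (- (2 * a)) / (2 * a)
              - G * Rpower t (- (1 + 2 * a))) <= RInt k e T).
  { rewrite Spl.
    set (A := Rpower rho (- (2 * a))) in *. set (B := Rpower s (- (2 * a))) in *.
    set (C := Rpower t (- (2 * a))) in *. set (E := Rpower T (- (2 * a))) in *.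
    replace (- K * ((B - A) / - (2 * a))) with (K * B / (2 * a) - K * A / (2 * a)) in N2
      by (field; lra).
    replace (- K * ((C - B) / - (2 * a))) with (K * C / (2 * a) - K * B / (2 * a)) in N3
      by (field; lra).
    replace (- K * ((E - C) / - (2 * a))) with (K * (E / (2 * a)) - K * C / (2 * a)) in N4
      by (field; lra).
    replace (- (2 * D) * Rpower rho (2 - 2 * a) / (2 - 2 * a))
      with (- (2 * D * Rpower rho (2 - 2 * a) / (2 - 2 * a))) in N1 by (field; lra).
    lra. }
  apply (Rmult_le_compat_l c) in Tot; [|lra].
  apply Rabs_def2 in Hlim. lra.
Qed.

(** * Convexity estimates for powers and existence of a contact point *)

Lemma Rpower_Bernoulli_le (y t : R) :
  0 < y -> 0 <= t <= 1 -> Rpower y t <= 1 + t * (y - 1).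
Proof.
  intros Hy Ht. unfold Rpower.
  set (L := ln y). rewrite <- (exp_ln y Hy) at 1. fold L.
  (* [exp] lies above its tangent at [t * L]; average its values at [L] and [0]. *)
  assert (E1 : exp L = exp (t * L) * exp (L - t * L)) by (rewrite <- exp_plus; f_equal; ring).
  assert (E2 : 1 = exp (t * L) * exp (- (t * L)))
    by (rewrite <- exp_plus, Rplus_opp_r; symmetry; apply exp_0).
  assert (H1 := exp_ineq1_le (L - t * L)). assert (H2 := exp_ineq1_le (- (t * L))).
  assert (Hp := exp_pos (t * L)).
  apply (Rmult_le_compat_l _ _ _ (Rlt_le _ _ Hp)) in H1.
  apply (Rmult_le_compat_l _ _ _ (Rlt_le _ _ Hp)) in H2.
  rewrite <- E1 in H1. rewrite <- E2 in H2.
  apply (Rmult_le_compat_l t) in H1; [|lra].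
  apply (Rmult_le_compat_l (1 - t)) in H2; [|lra].
  nra.
Qed.

(** Write (1 + s)^(- beta) as (1 + s)^(1 - beta) / (1 + s) and apply Bernoulli to the numerator;
    after clearing the denominator the slack is beta s^2 (1 + 2 s). *)
Lemma Rpower_opp_le_parabola (beta X s : R) :
  0 <= beta <= 1 -> 0 < X -> - (1 / 2) <= s ->
  Rpower (X * (1 + s)) (- beta) <= Rpower X (- beta) * (1 - beta * s + 2 * beta * s ^ 2).
Proof.
  intros Hb HX Hs.
  rewrite <- Rpower_mult_distr by lra.
  apply Rmult_le_compat_l; [left; apply exp_pos|].
  replace (- beta) with ((1 - beta) + - (1)) at 1 by ring.
  rewrite Rpower_plus, Rpower_Ropp, Rpower_1 by lra.
  assert (H := Rpower_Bernoulli_le (1 + s) (1 - beta) ltac:(lra) ltac:(lra)).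
  apply Rmult_le_reg_r with (1 + s); [lra|].
  rewrite Rmult_assoc, Rinv_l, Rmult_1_r by lra.
  eapply Rle_trans; [exact H|].
  assert (0 <= beta * (s ^ 2 * (1 + 2 * s))); [|nra].
  apply Rmult_le_pos; [lra|]. apply Rmult_le_pos; [apply pow2_ge_0|lra].
Qed.

(** Convexity: exp (- gamma ln (1 + s)) lies above its linearization, and ln (1 + s) <= s. *)
Lemma Rpower_opp_ge_tangent (gamma X s : R) :
  0 <= gamma -> 0 < X -> - (1) < s ->
  Rpower X (- gamma) * (1 - gamma * s) <= Rpower (X * (1 + s)) (- gamma).
Proof.
  intros Hg HX Hs.
  rewrite <- Rpower_mult_distr by lra.
  apply Rmult_le_compat_l; [left; apply exp_pos|].
  unfold Rpower.
  assert (H1 := exp_ineq1_le (- gamma * ln (1 + s))).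
  assert (H2 : ln (1 + s) <= s).
  { assert (H := exp_ineq1_le (ln (1 + s))). rewrite exp_ln in H by lra. lra. }
  nra.
Qed.

(** Far to the left [w] stays above the given negative value, so the minimum is attained on a
    compact interval; the sign at [b] keeps it away from that endpoint. *)
Lemma negative_min_exists (w : R -> R) (b : R) :
  (forall x, x <= b -> continuous w x) -> 0 <= w b ->
  (forall eps, 0 < eps -> exists A, forall x, x < A -> - eps < w x) ->
  (exists x, x <= b /\ w x < 0) ->
  exists x0, x0 < b /\ w x0 < 0 /\ forall z, z <= b -> w x0 <= w z.
Proof.
  intros Hc Hb Hlim (x1 & Hx1 & Hw1).
  destruct (Hlim (- w x1) ltac:(lra)) as (A & HA).
  assert (HxA : A <= x1).
  { destruct (Rle_or_lt A x1) as [H|H]; [exact H|]. specialize (HA _ H). lra. }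
  destruct (continuity_ab_min w A b ltac:(lra)) as (x0 & Hmin & Hx0).
  { intros z Hz. apply continuity_pt_filterlim, Hc. lra. }
  assert (H01 := Hmin x1 ltac:(lra)).
  exists x0. split; [|split; [lra|]].
  - destruct (Req_dec x0 b) as [->|]; lra.
  - intros z Hz. destruct (Rle_or_lt A z) as [H|H].
    + apply Hmin; lra.
    + specialize (HA _ H). lra.
Qed.

(** * Upper bound for the front *)

Lemma continuous_Rpower_opp (k x : R) :
  x < 0 -> continuous (fun z => Rpower (- z) k) x.
Proof.
  intros Hx. apply (continuous_comp (fun z => - z) (fun y => Rpower y k)).
  - apply (continuous_opp (fun z : R => z)), continuous_id.
  - apply continuous_ext with (fun y => 1 * Rpower y k).
    { intros; apply Rmult_1_l. }
    apply continuous_mult_Rpower; [lra|apply continuous_const].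
Qed.

(* Since [phi] is compared with [min 1 (M |x|^(1 - 2 a))], it can only be touched
   where [M |x|^(1 - 2 a) < 1]; this is what makes the local part of the
   fractional Laplacian of the barrier negligible for large [M]. *)
Lemma front_upper_bound (a c c0 : R) (phi dphi : R -> R) :
  1 / 2 < a < 1 -> 0 < c -> 0 < c0 ->
  (forall x y, x < y -> phi x < phi y) -> (forall x, 0 < phi x < 1) ->
  (forall x, derivable_pt_lim phi x (dphi x)) ->
  (forall x, x < 0 -> sym_frac_lap a c phi x (- (c0 * dphi x))) ->
  lim_minus_infty phi 0 ->
  exists M, 0 < M /\ forall x, x < 0 -> phi x <= M * Rpower (- x) (- (2 * a - 1)).
Proof.
  intros Ha Hc Hc0 Hinc H01 Hd Hlap Hlim.
  assert (Hcont : forall x, continuous phi x).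
  { intros x. apply continuity_pt_filterlim, derivable_continuous_pt.
    exists (dphi x). apply Hd. }
  assert (Hle : forall x y, x <= y -> phi x <= phi y).
  { intros x y [H| ->]; [left; now apply Hinc|right; reflexivity]. }
  assert (Pos : forall y w, 0 < Rpower y w) by (intros; apply exp_pos).
  set (beta := 2 * a - 1).
  assert (Hbeta : 0 < beta < 1) by (unfold beta; lra).
  set (H := Rpower (1 / 2) (- (2 * a))).
  set (Q := beta / (2 - 2 * a) + 1 / (2 * a)).
  assert (HQ : 0 < Q).
  { unfold Q. apply Rplus_lt_0_compat; apply Rdiv_lt_0_compat; lra. }
  assert (HHp : 0 < H) by apply Pos.
  (* [M] makes transport beat the nonlocal terms, as recorded in [HMQ]; adding 1 makes that
     inequality strict. *)
  set (M := c * H * Q / (c0 * beta) + 1).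
  assert (Hcb : 0 < c0 * beta) by (apply Rmult_lt_0_compat; lra).
  assert (HM : 0 < M).
  { unfold M. assert (0 < c * H * Q / (c0 * beta)); [|lra].
    apply Rdiv_lt_0_compat; [|exact Hcb].
    repeat apply Rmult_lt_0_compat; assumption. }
  assert (HMQ : c * H * Q < c0 * (M * beta)).
  { unfold M. replace (c0 * ((c * H * Q / (c0 * beta) + 1) * beta))
      with (c * H * Q + c0 * beta) by (field; lra). lra. }
  clearbody M.
  (* At distance [R0] from the origin the barrier equals 1; any closer, it dominates the front
     trivially. *)
  set (R0 := Rpower M (/ beta)).
  assert (HR0 : 0 < R0) by apply Pos.
  assert (HMR : M * Rpower R0 (- beta) = 1).
  { unfold R0. rewrite Rpower_mult.
    replace (/ beta * - beta) with (- (1)) by (field; lra).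
    rewrite Rpower_Ropp, Rpower_1 by exact HM. field. lra. }
  assert (Hdec : forall y z k, 0 < y <= z -> 0 <= k -> Rpower z (- k) <= Rpower y (- k)).
  { intros y z k Hy Hk. rewrite !Rpower_Ropp.
    apply Rinv_le_contravar; [apply Pos|]. now apply Rle_Rpower_l. }
  assert (Hbig : forall z, - R0 <= z < 0 -> 1 <= M * Rpower (- z) (- beta)).
  { intros z Hz. rewrite <- HMR. apply Rmult_le_compat_l; [lra|].
    apply Hdec; lra. }
  exists M. split; [exact HM|]. intros x Hx.
  destruct (Rle_or_lt (- R0) x) as [HxR|HxR].
  { specialize (Hbig x ltac:(lra)). specialize (H01 x). lra. }
  apply Rnot_lt_le. intros Hneg.
  destruct (negative_min_exists (fun z => M * Rpower (- z) (- beta) - phi z) (- R0))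
    as (x0 & Hx0 & Hw0 & Hmin).
  { intros z Hz.
    apply (continuous_minus (fun z => M * Rpower (- z) (- beta)) phi); [|apply Hcont].
    apply (continuous_scal_r M (fun z => Rpower (- z) (- beta))).
    apply continuous_Rpower_opp. lra. }
  { specialize (Hbig (- R0) ltac:(lra)). specialize (H01 (- R0)). lra. }
  { intros eps Heps. destruct (Hlim eps Heps) as (A & HA). exists A. intros y Hy.
    specialize (HA y Hy). apply Rabs_def2 in HA.
    assert (0 < M * Rpower (- y) (- beta)) by now apply Rmult_lt_0_compat. lra. }
  { exists x. split; lra. }
  cbv beta in Hw0, Hmin.
  set (X := - x0).
  assert (HX : 0 < X) by (unfold X; lra).
  set (P := Rpower X (- beta)).
  assert (HP : 0 < P) by apply Pos.
  assert (HMP : M * P <= 1).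
  { rewrite <- HMR. apply Rmult_le_compat_l; [lra|]. apply Hdec; unfold X; lra. }
  (* Left of [- R0] minimality compares [phi] with the barrier; to the right the barrier is at least
     1, while its gap at [x0] is negative. The parabola estimate then bounds the barrier. *)
  assert (Hnear : forall z, Rabs (z - x0) <= X / 2 -> phi z - phi x0
            <= (M * beta * P / X) * (z - x0) + (2 * beta * M * P / X ^ 2) * (z - x0) ^ 2).
  { intros z Hz. apply Rabs_le_between in Hz.
    set (s := (x0 - z) / X).
    assert (HsX : X * s = x0 - z) by (unfold s; field; lra).
    assert (Hs : - (1 / 2) <= s) by (apply Rmult_le_reg_l with X; lra).
    assert (Hp := Rpower_opp_le_parabola beta X s ltac:(lra) HX Hs).
    replace (X * (1 + s)) with (- z) in Hp
      by (rewrite Rmult_plus_distr_l, HsX; unfold X; ring).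
    fold P in Hp. fold X in Hw0. fold P in Hw0.
    apply Rle_trans with (M * Rpower (- z) (- beta) - M * P).
    - destruct (Rle_or_lt z (- R0)) as [Hz0|Hz0].
      + specialize (Hmin z Hz0). fold X in Hmin. fold P in Hmin. lra.
      + specialize (Hbig z ltac:(unfold X in *; lra)). specialize (H01 z). lra.
    - apply (Rmult_le_compat_l M) in Hp; [|lra].
      replace (M * beta * P / X * (z - x0) + 2 * beta * M * P / X ^ 2 * (z - x0) ^ 2)
        with (M * (P * (1 - beta * s + 2 * beta * s ^ 2)) - M * P); [lra|].
      unfold s. field. lra. }
  assert (Hslope := touching_slope phi x0 _ _ _ (X / 2) ltac:(lra) (Hd x0) Hnear).
  assert (HD : 0 <= 2 * beta * M * P / X ^ 2).
  { left. apply Rdiv_lt_0_compat; [|now apply pow_lt].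
    repeat apply Rmult_lt_0_compat; lra. }
  (* The window is a single point with zero gain: only the near and far bounds enter. *)
  assert (Hbd := touching_frac_lap a c phi (fun _ => 0) x0 _ _ _ (X / 2) 1 (X / 2) (X / 2) 0
    Ha Hc ltac:(lra) ltac:(lra) HD ltac:(lra) Hcont (Hlap x0 ltac:(lra)) Hnear).
  (* Monotonicity cancels the left jump against one copy of [phi x0]. *)
  assert (Hfar : forall r, X / 2 <= r -> phi (x0 + r) + phi (x0 - r) - 2 * phi x0 <= 1).
  { intros r Hr. assert (A1 := H01 (x0 + r)). assert (A2 := H01 x0).
    assert (A3 := Hle (x0 - r) x0 ltac:(lra)). lra. }
  specialize (Hbd Hfar (fun y => continuous_const 0 y) ltac:(intros; lra)).
  specialize (Hbd ltac:(intros r Hr; specialize (Hfar r ltac:(lra)); lra)).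
  specialize (Hbd ltac:(rewrite RInt_point; apply Rle_refl)).
  rewrite Hslope in Hbd.
  assert (Hr1 : Rpower (X / 2) (2 - 2 * a) = X ^ 2 / 4 * Rpower (X / 2) (- (2 * a))).
  { replace (2 - 2 * a) with (INR 2 + - (2 * a)) by (simpl; ring).
    rewrite Rpower_plus, Rpower_pow by lra. simpl. field. }
  assert (Hr2 : Rpower (X / 2) (- (2 * a)) = H * (P / X)).
  { replace (X / 2) with (1 / 2 * X) by field.
    rewrite <- Rpower_mult_distr by lra. fold H. f_equal.
    replace (- (2 * a)) with (- beta + - (1)) by (unfold beta; ring).
    rewrite Rpower_plus, (Rpower_Ropp X 1), Rpower_1 by exact HX. reflexivity. }
  rewrite Hr1, Hr2 in Hbd.
  set (Y := P / X) in *.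
  assert (HY : 0 < Y) by now apply Rdiv_lt_0_compat.
  (* [Y] is X^(- 2 a), the common order of both sides. Since M P <= 1, the right side is free of
     [M], which contradicts [HMQ]. *)
  assert (Hfin : c0 * (M * beta) * Y <= c * H * Q * Y).
  { apply Rle_trans with (- - (c0 * (M * beta * P / X))).
    { right. unfold Y. field. lra. }
    eapply Rle_trans; [exact Hbd|].
    rewrite !(Rmult_assoc c). apply Rmult_le_compat_l; [lra|].
    replace (2 * (2 * beta * M * P / X ^ 2) * (X ^ 2 / 4 * (H * Y)) / (2 - 2 * a)
             + 1 * (H * Y) / (2 * a) - 0 * Rpower (X / 2) (- (1 + 2 * a)))
      with (H * Y * ((M * P) * (beta / (2 - 2 * a)) + 1 / (2 * a))) by (field; lra).
    replace (H * Q * Y) with (H * Y * Q) by ring.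
    apply Rmult_le_compat_l; [left; now apply Rmult_lt_0_compat|].
    unfold Q. apply Rplus_le_compat_r.
    rewrite <- (Rmult_1_l (beta / (2 - 2 * a))) at 2.
    apply Rmult_le_compat_r; [left; apply Rdiv_lt_0_compat; lra|exact HMP]. }
  apply Rmult_le_reg_r in Hfin; lra.
Qed.

(** * Lower bound for the difference quotients *)

(** The integral telescopes to 1/h times the difference of the integrals of [u] over [t, t + h] and
    [s, s + h]; monotonicity bounds each by an endpoint value, so the estimate survives as [h] tends
    to 0. *)
Lemma RInt_diff_quot_ge (u : R -> R) (s t h : R) :
  (forall y, continuous u y) -> (forall x y, x <= y -> u x <= u y) ->
  s <= t -> 0 < h ->
  u t - u (s + h) <= RInt (fun r => (u (r + h) - u r) / h) s t.
Proof.
  intros Hc Hle Hst Hh.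
  assert (E : forall p q, ex_RInt u p q).
  { intros. apply (@ex_RInt_continuous R_CompleteNormedModule). intros; apply Hc. }
  assert (Ih : RInt u (s + h) (t + h) = RInt (fun r => u (r + h)) s t).
  { symmetry. etransitivity.
    - apply RInt_ext with (g := fun r => 1 * u (1 * r + h)).
      intros r _. rewrite !Rmult_1_l. reflexivity.
    - replace (s + h) with (1 * s + h) by ring. replace (t + h) with (1 * t + h) by ring.
      now apply (RInt_comp_lin (V := R_CompleteNormedModule) u). }
  assert (Eh : ex_RInt (fun r => u (r + h)) s t).
  { apply (@ex_RInt_continuous R_CompleteNormedModule). intros z _.
    apply (continuous_comp (fun r => r + h) u); [|apply Hc].
    apply (continuous_plus (fun r => r) (fun _ => h));
      [apply continuous_id|apply continuous_const]. }
  assert (Id : RInt (fun r => (u (r + h) - u r) / h) s t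
               = / h * (RInt u (s + h) (t + h) - RInt u s t)).
  { rewrite Ih.
    transitivity (RInt (fun r => / h * (u (r + h) - u r)) s t).
    { apply RInt_ext. intros r _. apply Rmult_comm. }
    etransitivity.
    - apply (RInt_scal (V := R_CompleteNormedModule) (fun r => u (r + h) - u r)).
      now apply (ex_RInt_minus (V := R_NormedModule) (fun r => u (r + h)) u).
    - apply (f_equal (Rmult (/ h))).
      now apply (RInt_minus (V := R_CompleteNormedModule) (fun r => u (r + h)) u). }
  assert (C1 := RInt_Chasles (V := R_CompleteNormedModule) u s (s + h) (t + h) (E _ _) (E _ _)).
  assert (C2 := RInt_Chasles (V := R_CompleteNormedModule) u s t (t + h) (E _ _) (E _ _)).
  unfold plus in C1, C2; simpl in C1, C2.
  assert (B1 : RInt u s (s + h) <= h * u (s + h)).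
  { replace (h * u (s + h)) with (RInt (fun _ => u (s + h)) s (s + h)).
    - apply RInt_le; [lra|apply E|apply ex_RInt_const|]. intros; apply Hle; lra.
    - rewrite RInt_const. unfold scal; simpl; unfold mult; simpl. ring. }
  assert (B2 : h * u t <= RInt u t (t + h)).
  { replace (h * u t) with (RInt (fun _ => u t) t (t + h)).
    - apply RInt_le; [lra|apply ex_RInt_const|apply E|]. intros; apply Hle; lra.
    - rewrite RInt_const. unfold scal; simpl; unfold mult; simpl. ring. }
  rewrite Id. apply Rmult_le_reg_l with h; [exact Hh|].
  rewrite <- Rmult_assoc, Rinv_r, Rmult_1_l by lra. lra.
Qed.

(* The barrier [m (z + 1/2)^2 |z|^(-2 - 2 a)], extended by [0] to [z >= -1/2], is
   semiconvex, and the mass of the difference quotient over [-1/4, 0] alone beats its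
   fractional Laplacian and transport term once [m] is small. *)
Lemma front_diff_quot_lower_bound (a c c0 : R) (phi dphi : R -> R) :
  1 / 2 < a < 1 -> 0 < c -> 0 < c0 ->
  (forall x y, x < y -> phi x < phi y) ->
  (forall x, derivable_pt_lim phi x (dphi x)) ->
  (forall x, x < 0 -> sym_frac_lap a c phi x (- (c0 * dphi x))) ->
  exists m, 0 < m /\ forall h, 0 < h <= 1 / 8 -> forall z, z <= - (1 / 2) ->
    m * ((z + 1 / 2) ^ 2 * Rpower (- z) (- (2 + 2 * a))) <= (phi (z + h) - phi z) / h.
Proof.
  intros Ha Hc Hc0 Hinc Hd Hlap.
  assert (Hcont : forall x, continuous phi x).
  { intros x. apply continuity_pt_filterlim, derivable_continuous_pt.
    exists (dphi x). apply Hd. }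
  assert (Hle : forall x y, x <= y -> phi x <= phi y).
  { intros x y [H| ->]; [left; now apply Hinc|right; reflexivity]. }
  assert (Pos : forall y w, 0 < Rpower y w) by (intros; apply exp_pos).
  set (gamma := 2 + 2 * a).
  assert (Hgamma : 3 < gamma < 4) by (unfold gamma; lra).
  set (H := Rpower (1 / 2) (- (2 * a))).
  set (J := Rpower (1 / 2) (- (2 * a - 1))).
  (* What remains of the increment of [phi] over [-1/4, 0] after a loss of length [h] <= 1/8 at its
     left end. *)
  set (G := phi 0 - phi (- (1 / 8))).
  assert (HG : 0 < G) by (unfold G; specialize (Hinc (- (1 / 8)) 0 ltac:(lra)); lra).
  assert (HH : 0 < H) by apply Pos. assert (HJ : 0 < J) by apply Pos.
  (* The 5 is 2 * 10 / 4, from the paraboloid coefficient 10 and the radius X / 2 squared; the 2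
     comes from the far bound on two jumps. *)
  set (Q := 5 / (2 - 2 * a) + 2 / (2 * a)).
  assert (HQ : 0 < Q).
  { unfold Q. apply Rplus_lt_0_compat; apply Rdiv_lt_0_compat; lra. }
  set (W := c0 * gamma + c * (H * J * Q)).
  assert (HW : 0 < W).
  { unfold W. apply Rplus_lt_0_compat; repeat apply Rmult_lt_0_compat; lra. }
  assert (HcG : 0 < c * G) by now apply Rmult_lt_0_compat.
  (* [W] is the transport and nonlocal cost per unit of [m]; this choice spends half of the forcing
     [c * G]. *)
  set (m := c * G / (2 * W)).
  assert (Hm : 0 < m) by (apply Rdiv_lt_0_compat; lra).
  assert (HmW : m * W < c * G).
  { unfold m. replace (c * G / (2 * W) * W) with (c * G / 2) by (field; lra). lra. }
  clearbody m.
  exists m. split; [exact Hm|]. intros h Hh z1 Hz1.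
  set (N := fun y => (phi (y + h) - phi y) / h).
  set (q := fun z => (z + 1 / 2) ^ 2 * Rpower (- z) (- gamma)).
  change (m * q z1 <= N z1).
  assert (HcN : forall y, continuous N y).
  { intros y. unfold N.
    apply continuous_ext with (fun y => / h * (phi (y + h) - phi y)).
    { intros; apply Rmult_comm. }
    apply (continuous_scal_r (/ h) (fun y => phi (y + h) - phi y)).
    apply (continuous_minus (fun y => phi (y + h)) phi); [|apply Hcont].
    apply (continuous_comp (fun y => y + h) phi); [|apply Hcont].
    apply (continuous_plus (fun y => y) (fun _ => h));
      [apply continuous_id|apply continuous_const]. }
  assert (HN0 : forall y, 0 <= N y).
  { intros y. unfold N. apply Rmult_le_pos.
    - specialize (Hle y (y + h) ltac:(lra)). lra.
    - left. apply Rinv_0_lt_compat. lra. }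
  assert (Hq0 : forall z, 0 <= q z).
  { intros z. apply Rmult_le_pos; [apply pow2_ge_0|left; apply Pos]. }
  apply Rnot_lt_le. intros Hneg.
  destruct (negative_min_exists (fun z => N z - m * q z) (- (1 / 2)))
    as (x0 & Hx0 & Hw0 & Hmin).
  { intros z Hz.
    apply (continuous_minus N (fun z => m * q z)); [apply HcN|].
    apply (continuous_scal_r m q).
    apply (continuous_mult (fun z => (z + 1 / 2) ^ 2) (fun z => Rpower (- z) (- gamma))).
    - apply (ex_derive_continuous (fun z => (z + 1 / 2) ^ 2)). auto_derive. exact I.
    - apply continuous_Rpower_opp. lra. }
  { specialize (HN0 (- (1 / 2))).
    assert (q (- (1 / 2)) = 0) as ->; [unfold q; ring|lra]. }
  { intros eps Heps. exists (- (1 + m / eps)). intros y Hy.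
    assert (Hme : 0 < m / eps) by now apply Rdiv_lt_0_compat.
    specialize (HN0 y). enough (m * q y < eps) by lra.
    (* The exponent 2 - gamma = - 2 a is below -1, and - y > 1. *)
    assert (Hqy : q y <= / (- y)).
    { unfold q. apply Rle_trans with ((- y) ^ 2 * Rpower (- y) (- gamma)).
      - apply Rmult_le_compat_r; [left; apply Pos|]. nra.
      - rewrite <- Rpower_pow, <- Rpower_plus by lra.
        rewrite <- (Rpower_1 (- y)) at 2 by lra. rewrite <- Rpower_Ropp.
        apply Rle_Rpower; [lra|]. unfold gamma. simpl. lra. }
    apply (Rmult_le_compat_l m) in Hqy; [|lra].
    eapply Rle_lt_trans; [exact Hqy|].
    apply Rmult_lt_reg_r with (- y); [lra|].
    rewrite Rmult_assoc, Rinv_l, Rmult_1_r by lra.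
    replace m with (eps * (m / eps)) at 1 by (field; lra).
    apply Rmult_lt_compat_l; lra. }
  { exists z1. split; [lra|]. lra. }
  cbv beta in Hw0, Hmin.
  set (X := - x0).
  assert (HX : 1 / 2 < X) by (unfold X; lra).
  set (P := Rpower X (- gamma)).
  assert (HP : 0 < P) by apply Pos.
  set (A := X - 1 / 2).
  assert (HA : 0 < A <= X) by (unfold A; lra).
  assert (Hqx : q x0 = A ^ 2 * P).
  { unfold q. fold X. fold P. unfold A, X. ring. }
  rewrite Hqx in Hw0, Hmin.
  (* Negation turns contact of [N] with the barrier from below into contact from above. *)
  set (u := fun y => (phi y - phi (y + h)) / h).
  assert (HuN : forall y, u y = - N y) by (intros y; unfold u, N; field; lra).
  assert (Hup : forall z, u z - u x0 <= m * (A ^ 2 * P)).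
  { intros z. rewrite !HuN. specialize (HN0 z). lra. }
  (* The slope of - m q at [x0]. *)
  set (b := m * P * (2 * A * X - gamma * A ^ 2) / X).
  assert (Hnear : forall z, Rabs (z - x0) <= X / 2 ->
     u z - u x0 <= b * (z - x0) + (10 * m * P) * (z - x0) ^ 2).
  { intros z Hz. apply Rabs_le_between in Hz.
    set (s := (x0 - z) / X).
    assert (HsX : X * s = x0 - z) by (unfold s; field; lra).
    assert (Hs : - (1 / 2) <= s <= 1 / 2) by (split; apply Rmult_le_reg_l with X; lra).
    replace (b * (z - x0) + 10 * m * P * (z - x0) ^ 2)
      with (m * P * (- s * (2 * A * X - gamma * A ^ 2) + 10 * (X * s) ^ 2))
      by (unfold b; rewrite HsX; unfold s; field; lra).
    assert (HmP : 0 < m * P) by now apply Rmult_lt_0_compat.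
    set (T := X * s) in *.
    destruct (Rle_or_lt z (- (1 / 2))) as [Hz0|Hz0].
    - assert (Hp := Rpower_opp_ge_tangent gamma X s ltac:(lra) ltac:(lra) ltac:(lra)).
      replace (X * (1 + s)) with (- z) in Hp
        by (rewrite Rmult_plus_distr_l; fold T; rewrite HsX; unfold X; ring).
      fold P in Hp.
      specialize (Hmin z Hz0).
      assert (Hqz : (A + T) ^ 2 * (P * (1 - gamma * s)) <= q z).
      { unfold q. replace (z + 1 / 2) with (- (A + T)) by (rewrite HsX; unfold A, X; ring).
        replace ((- (A + T)) ^ 2) with ((A + T) ^ 2) by ring.
        apply Rmult_le_compat_l; [apply pow2_ge_0|exact Hp]. }
      apply (Rmult_le_compat_l m) in Hqz; [|lra].
      rewrite !HuN.
      apply Rle_trans with (m * P * (A ^ 2 - (A + T) ^ 2 * (1 - gamma * s))); [lra|].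
      apply Rmult_le_compat_l; [lra|].
      assert (HT : - s * (2 * A * X - gamma * A ^ 2) = - 2 * A * T + gamma * A ^ 2 * s)
        by (unfold T; ring).
      rewrite HT.
      assert (HATs : A * T * s <= T ^ 2).
      { replace (A * T * s) with (A * (X * s ^ 2)) by (unfold T; ring).
        replace (T ^ 2) with (X * (X * s ^ 2)) by (unfold T; ring).
        apply Rmult_le_compat_r; [|lra].
        apply Rmult_le_pos; [lra|apply pow2_ge_0]. }
      assert (HTs : T ^ 2 * s <= T ^ 2 / 2) by (assert (Ht := pow2_ge_0 T); nra).
      assert (Ht := pow2_ge_0 T).
      assert (HATs0 : 0 <= A * T * s).
      { replace (A * T * s) with (A * (X * s ^ 2)) by (unfold T; ring).
        apply Rmult_le_pos; [lra|]. apply Rmult_le_pos; [lra|apply pow2_ge_0]. }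
      (* Source of the coefficient 10: gamma < 4, A T s <= T^2 and T^2 s <= T^2 / 2. *)
      assert (gamma * (2 * (A * T * s) + T ^ 2 * s) <= 4 * (5 / 2 * T ^ 2)) by nra.
      lra.
    (* Past -1/2 the barrier is 0; the displacement then exceeds [A], so the quadratic term absorbs
       A^2. *)
    - eapply Rle_trans; [apply Hup|].
      replace (m * (A ^ 2 * P)) with (m * P * A ^ 2) by ring.
      apply Rmult_le_compat_l; [lra|].
      assert (HT0 : T < - A) by (rewrite HsX; unfold A, X; lra).
      assert (Hs0 : s < 0) by (apply Rmult_lt_reg_l with X; [lra|]; fold T; lra).
      assert (HAT : A ^ 2 <= T ^ 2) by nra.
      replace (- s * (2 * A * X - gamma * A ^ 2)) with (- 2 * A * T + gamma * A ^ 2 * s)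
        by (unfold T; ring).
      assert (- (T ^ 2) <= 2 * (A ^ 2 * s)) by nra.
      assert (0 <= - A * T) by nra.
      nra. }
  assert (Hdu : derivable_pt_lim u x0 ((dphi x0 - dphi (x0 + h)) / h)).
  { apply is_derive_Reals. unfold u.
    apply is_derive_ext with (fun y => / h * (phi y - phi (y + h))).
    { intros; apply Rmult_comm. }
    replace ((dphi x0 - dphi (x0 + h)) / h) with (/ h * (dphi x0 - dphi (x0 + h)))
      by apply Rmult_comm.
    apply (is_derive_scal (fun y => phi y - phi (y + h))).
    apply (is_derive_minus phi (fun y => phi (y + h))).
    - apply is_derive_Reals, Hd.
    - replace (dphi (x0 + h)) with (scal 1 (dphi (x0 + h)))
        by (unfold scal; simpl; unfold mult; simpl; ring).
      apply (is_derive_comp phi (fun y => y + h)).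
      + apply is_derive_Reals, Hd.
      + auto_derive; [exact I|ring]. }
  assert (Hslope := touching_slope u x0 _ _ _ (X / 2) ltac:(lra) Hdu Hnear).
  assert (Hcu : forall y, continuous u y).
  { intros y. apply continuous_ext with (fun y => - N y).
    - intros; symmetry; apply HuN.
    - apply (continuous_opp N), HcN. }
  assert (Hl := sym_frac_lap_neg_diff_quot a c h phi x0 _ _ Hcont
    (Hlap x0 ltac:(lra)) (Hlap (x0 + h) ltac:(lra)) ltac:(lra)).
  fold u in Hl.
  assert (HmAP : 0 <= m * (A ^ 2 * P)).
  { apply Rmult_le_pos; [lra|]. apply Rmult_le_pos; [apply pow2_ge_0|lra]. }
  assert (HmP : 0 < m * P) by now apply Rmult_lt_0_compat.
  (* For r in [X - 1/4, X] the point x0 + r runs over [-1/4, 0], where the gain is [N] itself; X >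
     1/2 puts this window beyond the radius X / 2. *)
  assert (Hbd := touching_frac_lap a c u (fun r => N (x0 + r)) x0 _ b (10 * m * P) (X / 2)
    (2 * (m * (A ^ 2 * P))) (X - 1 / 4) X G
    Ha Hc ltac:(lra) ltac:(lra) ltac:(lra) ltac:(lra) Hcu Hl Hnear).
  specialize (Hbd ltac:(intros r _; assert (U1 := Hup (x0 + r)); assert (U2 := Hup (x0 - r)); lra)).
  assert (HcNs : forall y, continuous (fun r => N (x0 + r)) y).
  { intros y. apply (continuous_comp (fun r => x0 + r) N); [|apply HcN].
    apply (continuous_plus (fun _ => x0) (fun r => r));
      [apply continuous_const|apply continuous_id]. }
  specialize (Hbd HcNs ltac:(intros; apply HN0)).
  specialize (Hbd ltac:(intros r _; assert (U2 := Hup (x0 - r)); rewrite !HuN in *; lra)).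
  assert (HGI : G <= RInt (fun r => N (x0 + r)) (X - 1 / 4) X).
  { apply Rle_trans with (phi (x0 + X) - phi (x0 + (X - 1 / 4 + h))).
    - unfold G. replace (x0 + X) with 0 by (unfold X; ring).
      assert (phi (x0 + (X - 1 / 4 + h)) <= phi (- (1 / 8))); [|lra].
      apply Hle. unfold X. lra.
    - assert (HcS : forall y, continuous (fun r => phi (x0 + r)) y).
      { intros y. apply (continuous_comp (fun r => x0 + r) phi); [|apply Hcont].
        apply (continuous_plus (fun _ => x0) (fun r => r));
          [apply continuous_const|apply continuous_id]. }
      assert (HI := RInt_diff_quot_ge (fun r => phi (x0 + r)) (X - 1 / 4) X h HcS
        ltac:(intros; apply Hle; lra) ltac:(lra) ltac:(lra)).
      cbv beta in HI.
      eapply Rle_trans; [exact HI|]. right. apply RInt_ext. intros r _.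
      unfold N. rewrite !Rplus_assoc. reflexivity. }
  specialize (Hbd HGI).
  replace (- ((- (c0 * dphi x0) - - (c0 * dphi (x0 + h))) / h))
    with (c0 * ((dphi x0 - dphi (x0 + h)) / h)) in Hbd by (field; lra).
  rewrite Hslope in Hbd.
  (* [Y] is X^(- (1 + 2 a)), the weight of a jump from [x0] to the origin. *)
  set (Y := P * X).
  assert (HY : 0 < Y) by (apply Rmult_lt_0_compat; lra).
  assert (HYe : Rpower X (- (1 + 2 * a)) = Y).
  { unfold Y, P. rewrite <- (Rpower_1 X) at 3 by lra. rewrite <- Rpower_plus.
    f_equal. unfold gamma. ring. }
  assert (Hr1 : Rpower (X / 2) (2 - 2 * a) = X ^ 2 / 4 * Rpower (X / 2) (- (2 * a))).
  { replace (2 - 2 * a) with (INR 2 + - (2 * a)) by (simpl; ring).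
    rewrite Rpower_plus, Rpower_pow by lra. simpl. field. }
  (* On X >= 1/2 the power X^(1 - 2 a) is at most its value [J] at 1/2. *)
  assert (Hr2 : X * Rpower (X / 2) (- (2 * a)) <= H * J).
  { replace (X / 2) with (1 / 2 * X) by field.
    rewrite <- Rpower_mult_distr by lra. fold H.
    replace (X * (H * Rpower X (- (2 * a)))) with (H * (Rpower X (- (2 * a)) * X)) by ring.
    apply Rmult_le_compat_l; [lra|].
    rewrite <- (Rpower_1 X) at 2 by lra. rewrite <- Rpower_plus.
    replace (- (2 * a) + 1) with (- (2 * a - 1)) by ring.
    unfold J. rewrite !Rpower_Ropp. apply Rinv_le_contravar; [apply Pos|].
    apply Rle_Rpower_l; lra. }
  rewrite Hr1, HYe in Hbd.
  set (E := Rpower (X / 2) (- (2 * a))) in *.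
  assert (HE : 0 < E) by apply Pos.
  assert (HA2 : A ^ 2 <= X ^ 2) by (apply pow_incr; lra).
  assert (L1 : - (c0 * gamma) * m * Y <= c0 * b).
  { unfold b. replace (- (c0 * gamma) * m * Y) with (c0 * (m * P) * (- gamma * X))
      by (unfold Y; ring).
    replace (c0 * (m * P * (2 * A * X - gamma * A ^ 2) / X))
      with (c0 * (m * P) * ((2 * A * X - gamma * A ^ 2) / X)) by (field; lra).
    apply Rmult_le_compat_l; [left; now apply Rmult_lt_0_compat|].
    apply Rmult_le_reg_r with X; [lra|].
    unfold Rdiv. rewrite (Rmult_assoc _ (/ X) X), Rinv_l, Rmult_1_r by lra.
    assert (0 <= 2 * A * X) by nra. nra. }
  assert (L2 : 2 * (10 * m * P) * (X ^ 2 / 4 * E) / (2 - 2 * a)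
               + 2 * (m * (A ^ 2 * P)) * E / (2 * a) <= m * Y * (H * J * Q)).
  { apply Rle_trans with (m * Y * (X * E * Q)).
    - replace (m * Y * (X * E * Q))
        with (2 * (10 * m * P) * (X ^ 2 / 4 * E) / (2 - 2 * a)
              + 2 * (m * (X ^ 2 * P)) * E / (2 * a)) by (unfold Y, Q; field; lra).
      apply Rplus_le_compat_l. unfold Rdiv.
      apply Rmult_le_compat_r; [left; apply Rinv_0_lt_compat; lra|].
      apply Rmult_le_compat_r; [lra|].
      apply Rmult_le_compat_l; [lra|]. apply Rmult_le_compat_l; [lra|].
      apply Rmult_le_compat_r; lra.
    - apply Rmult_le_compat_l; [left; now apply Rmult_lt_0_compat|].
      apply Rmult_le_compat_r; lra. }
  apply (Rmult_le_compat_l c) in L2; [|lra].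
  (* All terms now scale like [Y]; dividing by it contradicts [HmW]. *)
  assert (Hfin : c * G * Y <= m * W * Y) by (unfold W; lra).
  apply Rmult_le_reg_r in Hfin; lra.
Qed.

(** * Passage to the derivative and reduction of the theorem to the two bounds *)

Lemma deriv_ge_of_diff_quot_ge (u : R -> R) (x l p d0 : R) :
  derivable_pt_lim u x l -> 0 < d0 ->
  (forall h, 0 < h <= d0 -> p <= (u (x + h) - u x) / h) -> p <= l.
Proof.
  intros Hl Hd0 Hp. apply Rnot_lt_le. intros Hlt.
  destruct (Hl (p - l) ltac:(lra)) as ([d Hd] & H). simpl in H.
  set (h := Rmin (d / 2) d0).
  assert (H1 := Rmin_l (d / 2) d0). assert (H2 := Rmin_r (d / 2) d0).
  assert (Hh : 0 < h) by (apply Rmin_glb_lt; lra).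
  fold h in H1, H2.
  specialize (H h ltac:(lra) ltac:(rewrite Rabs_pos_eq; lra)).
  specialize (Hp h ltac:(lra)). apply Rabs_def2 in H. lra.
Qed.

Lemma support_is_zero_left (f : R -> R) (s t x : R) :
  support_is f s t -> x < s -> f x = 0.
Proof.
  intros Hf Hx. destruct (Req_dec (f x) 0) as [H|H]; [exact H|].
  destruct (Hf x) as [_ H2]. enough (s <= x <= t) by lra.
  apply H2. intros eps Heps. exists x.
  rewrite Rminus_diag, Rabs_R0. now split.
Qed.

(** Every wide enough truncated integral contains the positive mass of [1, 2]; taking that mass as
    the tolerance forces the limit to be positive. *)
Lemma is_c_alpha_pos (a c : R) : is_c_alpha a c -> 0 < c.
Proof.
  intros (l & Hl & ->). apply Rinv_0_lt_compat.
  enough (0 < l) by lra.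
  set (g := fun z => (1 - cos z) / Rpower z (1 + 2 * a)) in *.
  assert (Hcg : forall z, 0 < z -> continuous g z).
  { intros z Hz.
    apply continuous_ext with (fun z => (1 - cos z) * Rpower z (- (1 + 2 * a))).
    { intros y. unfold g. now rewrite Rpower_Ropp. }
    apply (continuous_mult_Rpower (fun z => 1 - cos z)); [exact Hz|].
    apply (ex_derive_continuous (fun z => 1 - cos z)). auto_derive. exact I. }
  assert (Eg : forall p q, 0 < p <= q -> ex_RInt g p q).
  { intros p q Hpq. apply (@ex_RInt_continuous R_CompleteNormedModule).
    intros z Hz. rewrite Rmin_left in Hz by lra. apply Hcg. lra. }
  assert (Hg0 : forall z, 0 <= g z).
  { intros z. unfold g. apply Rmult_le_pos; [assert (H := COS_bound z); lra|].
    left. apply Rinv_0_lt_compat, exp_pos. }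
  assert (Hmid : 0 < RInt g 1 2).
  { apply RInt_gt_0; [lra| |].
    - intros z Hz. unfold g. apply Rdiv_lt_0_compat; [|apply exp_pos].
      assert (cos z < cos 0); [|rewrite cos_0 in *; lra].
      assert (HPI := PI2_1). apply cos_decreasing_1; lra.
    - intros z Hz. apply Hcg. lra. }
  destruct (Hl _ Hmid) as (d & K & Hd & HK & H).
  set (e := Rmin d 1 / 2).
  assert (He : 0 < e < d /\ e < 1).
  { unfold e. assert (H1 := Rmin_l d 1). assert (H2 := Rmin_r d 1).
    assert (0 < Rmin d 1) by (apply Rmin_glb_lt; lra). lra. }
  destruct (H e (K + 2) ltac:(lra) ltac:(lra)) as (v & [pr <-] & Hv).
  rewrite <- RInt_Reals in Hv. clear pr.
  assert (C1 := RInt_Chasles (V := R_CompleteNormedModule) g e 1 2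
    (Eg e 1 ltac:(lra)) (Eg 1 2 ltac:(lra))).
  assert (C2 := RInt_Chasles (V := R_CompleteNormedModule) g e 2 (K + 2)
    (Eg e 2 ltac:(lra)) (Eg 2 (K + 2) ltac:(lra))).
  assert (P1 : 0 <= RInt g e 1) by (apply RInt_ge_0; [lra|apply Eg; lra|intros; apply Hg0]).
  assert (P2 : 0 <= RInt g 2 (K + 2)) by (apply RInt_ge_0; [lra|apply Eg; lra|intros; apply Hg0]).
  unfold plus in C1, C2; simpl in C1, C2. apply Rabs_def2 in Hv. lra.
Qed.

(** Moving by 1 makes a violation strict; monotonicity then keeps [u] a fixed distance from its
    limit. *)
Lemma increasing_front_bounds (u : R -> R) :
  (forall x y, x < y -> u x < u y) ->
  lim_minus_infty u 0 -> lim_plus_infty u 1 -> forall x, 0 < u x < 1.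
Proof.
  intros Hinc Hm Hp x. split; apply Rnot_le_lt; intros Hx.
  - assert (H1 := Hinc (x - 1) x ltac:(lra)).
    destruct (Hm (- u (x - 1)) ltac:(lra)) as (A & HA).
    set (z := Rmin A (x - 1) - 1).
    assert (Z1 := Rmin_l A (x - 1)). assert (Z2 := Rmin_r A (x - 1)).
    specialize (HA z ltac:(unfold z; lra)). apply Rabs_def2 in HA.
    specialize (Hinc z (x - 1) ltac:(unfold z; lra)). lra.
  - assert (H1 := Hinc x (x + 1) ltac:(lra)).
    destruct (Hp (u (x + 1) - 1) ltac:(lra)) as (A & HA).
    set (z := Rmax A (x + 1) + 1).
    assert (Z1 := Rmax_l A (x + 1)). assert (Z2 := Rmax_r A (x + 1)).
    specialize (HA z ltac:(unfold z; lra)). apply Rabs_def2 in HA.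
    specialize (Hinc (x + 1) z ltac:(unfold z; lra)). lra.
Qed.

Theorem theorem1p2 (alpha c theta : R) (f : R -> R) (phi0 dphi0 : R -> R) (c0 : R) :
  1 / 2 < alpha < 1 ->
  is_c_alpha alpha c ->
  0 < theta < 1 ->
  continuity f ->
  (forall u, 0 <= f u) ->
  support_is f theta 1 ->
  (exists l, left_deriv f 1 l /\ l < 0) ->
  (* (phi0, c0): the (unique) solution, with c0 > 0 and phi0 increasing *)
  0 < c0 ->
  (forall x y, x < y -> phi0 x < phi0 y) ->
  (forall x, derivable_pt_lim phi0 x (dphi0 x)) ->
  (forall x, frac_lap alpha c phi0 x (f (phi0 x) - c0 * dphi0 x)) ->
  lim_minus_infty phi0 0 ->
  lim_plus_infty phi0 1 ->
  phi0 0 = theta ->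
  exists m M, 0 < m /\ 0 < M /\
    forall x, x <= -1 ->
      phi0 x <= M / Rpower (Rabs x) (2 * alpha - 1) /\
      dphi0 x >= m / Rpower (Rabs x) (2 * alpha).
Proof.
  intros Ha Hca _ _ _ Hsupp _ Hc0 Hinc Hd Heq Hm Hp H0.
  assert (Hc := is_c_alpha_pos _ _ Hca).
  (* Left of 0 the front lies below [theta], where [f] vanishes. *)
  assert (Hlap : forall x, x < 0 -> sym_frac_lap alpha c phi0 x (- (c0 * dphi0 x))).
  { intros x Hx. specialize (Heq x).
    rewrite (support_is_zero_left f theta 1) in Heq;
      [|exact Hsupp|rewrite <- H0; now apply Hinc].
    rewrite Rminus_0_l in Heq. now apply frac_lap_sym. }
  destruct (front_upper_bound alpha c c0 phi0 dphi0) as (M & HM & Hup); try assumption.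
  { now apply increasing_front_bounds. }
  destruct (front_diff_quot_lower_bound alpha c c0 phi0 dphi0) as (m & Hm0 & Hlow);
    try assumption.
  (* The 4 comes from (x + 1/2)^2 >= x^2 / 4 for x <= -1. *)
  exists (m / 4), M. split; [lra|]. split; [exact HM|].
  intros x Hx. rewrite Rabs_left by lra. split.
  - specialize (Hup x ltac:(lra)). rewrite Rpower_Ropp in Hup. exact Hup.
  - apply Rle_ge.
    eapply Rle_trans; [|apply (deriv_ge_of_diff_quot_ge phi0 x _ _ (1 / 8) (Hd x) ltac:(lra));
      intros h Hh; apply (Hlow h Hh x); lra].
    unfold Rdiv. rewrite Rmult_assoc. apply Rmult_le_compat_l; [lra|].
    replace (- (2 + 2 * alpha)) with (- INR 2 + - (2 * alpha)) by (simpl; ring).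
    rewrite Rpower_plus, (Rpower_Ropp (- x) (INR 2)), Rpower_pow by lra.
    rewrite Rpower_Ropp, <- Rmult_assoc.
    apply Rmult_le_compat_r; [left; apply Rinv_0_lt_compat, exp_pos|].
    apply Rmult_le_reg_r with ((- x) ^ 2); [apply pow_lt; lra|].
    rewrite (Rmult_assoc _ (/ _)), Rinv_l, Rmult_1_r by (apply pow_nonzero; lra).
    nra.
Qed.
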